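(* Let $h\ge 1$, let $n_1<\ldots<n_h$ be positive integers, let $s_1,\ldots,s_h$ be positive integers, and let $a_{\ell,i}$ ($1\le \ell\le h$, $1\le i\le s_\ell$) be integers. Consider the Diophantine equation $$\sum_{\ell=1}^h\left(\sum_{i=1}^{s_\ell}a_{\ell,i}\,x_{\ell,i}^{n_\ell}\right)=0$$ in the unknowns $x_{\ell,i}$ ($1\le \ell\le h$, $1\le i\le s_\ell$), where (1) $\sum_{i\in\Gamma_\ell}a_{\ell,i}\neq 0$ for every $\ell\in[h]$ and for every nonempty $\Gamma_\ell\subseteq[s_\ell]$. Suppose there exists a prime number $p$ that satisfies the following: (2) there exists $\ell'\in[h]$ such that $p\nmid\sum_{i=1}^{s_{\ell'}}a_{\ell',i}$ and $p\mid\sum_{i=1}^{s_\ell}a_{\ell,i}$ for every $\ell\in[h]$ with $\ell\neq\ell'$; (3) for all $\ell,k\in[h]$ with $k>\ell$ and for every nonempty $\Gamma_\ell\subseteq[s_\ell]$, one has $p^{\,n_k-n_\ell}\nmid\sum_{i\in\Gamma_\ell}a_{\ell,i}$. Then the equation is not partition regular on $\mathbb{N}$, except possibly for constant solutions.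
   Context: $\mathbb{N}$ denotes the set of positive integers and $[n]=\{1,\ldots,n\}$. An equation $f(x_1,\ldots,x_n)=0$ is partition regular on $\mathbb{N}$ if for every finite coloring (partition) $\mathbb{N}=C_1\cup\ldots\cup C_r$ there exist an index $i$ and elements $a_1,\ldots,a_n\in C_i$ (not necessarily distinct) with $f(a_1,\ldots,a_n)=0$; such a solution is called monochromatic. A solution is constant if all unknowns take the same value. ''Not partition regular on $\mathbb{N}$, except possibly for constant solutions'' means: there is a finite coloring of $\mathbb{N}$ for which every monochromatic solution of the equation (if there is any) is constant. *)

(* Defs.v *)
From mathcomp Require Import all_boot all_order all_algebra.

Set Implicit Arguments.
Unset Strict Implicit.
Unset Printing Implicit Defensive.

Import GRing.Theory.
Local Open Scope ring_scope.

Section PartitionRegularity.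

(* [I] indexes the unknowns of the equation [f x = 0].  A finite coloring of
   the positive integers is a map [c : nat -> 'I_r]; the color of 0 plays no
   role, since only positive assignments are considered. *)
Variable I : Type.
Implicit Types (f : (I -> nat) -> int) (x : I -> nat).

Definition positive_solution f x : Prop := (forall i, 0 < x i)%N /\ f x = 0.

Definition monochromatic r (c : nat -> 'I_r) x : Prop :=
  exists k : 'I_r, forall i, c (x i) = k.

Definition constant_assignment x : Prop := forall i j, x i = x j.

Definition not_partition_regular_except_constant f : Prop :=
  exists (r : nat) (c : nat -> 'I_r),
    forall x, positive_solution f x -> monochromatic c x ->
      constant_assignment x.

End PartitionRegularity.

(* The unknown x_{l,i} is indexed by the pair [Tagged _ i : {l & 'I_(s l)}]. *)
Definition diagonal_form (h : nat) (n s : 'I_h -> nat)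
    (a : forall l : 'I_h, 'I_(s l) -> int)
    (x : {l : 'I_h & 'I_(s l)} -> nat) : int :=
  \sum_(l < h) \sum_(i < s l)
    a l i * (x (Tagged (fun l => 'I_(s l)) i))%:Z ^+ n l.

(* Main.v *)
Require Import Defs.
From mathcomp Require Import all_boot all_order all_algebra.
From mathcomp Require Import zify.

Set Implicit Arguments.
Unset Strict Implicit.
Unset Printing Implicit Defensive.

Import GRing.Theory.
Local Open Scope ring_scope.

(** Write each unknown as p ^ v * u with u prime to p, and color it by three
data: whether v = 0, a color g v of the valuation, and u modulo a large power
p ^ E.  No assignment that is monochromatic for this coloring solves the
equation.

If the common color says v = 0, all unknowns are congruent to one u modulo p,
the block of degree n l is congruent to u ^ n l times its full coefficient sum,
and (2) leaves exactly one block that is nonzero modulo p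
([diagonal_form_ndvd]).

Otherwise all valuations are positive.  In block l let w l be the least
valuation of an unknown, G l the set of indices attaining it, and e l the
p-adic valuation of \sum_(i in G l) a l i, which is finite by (1) and below E
by the choice of E.  Since the unknowns have the same p-free part modulo p ^ E,
the block has valuation exactly n l * w l + e l ([exact_val_block]), unless an
index outside G l interferes.  If these numbers are pairwise distinct, the
smallest one is the valuation of the whole sum, which is thus nonzero
([exact_val_sum_inj]).

Both the interference and a coincidence n l * w l + e l = n k * w k + e k are
relations n l * v + d = n k * w + e with d, e < E between two valuations.  For
given v, l, k, d, e such a relation determines w, so a graph of bounded degree
describes it, and a greedy coloring g of the vertices forces v = w whenever
g v = g w ([separating_coloring]).  This excludes interference outright.  In a
coincidence with l < k it gives w l = w k =: w > 0, whence
e l = (n k - n l) * w + e k >= n k - n l, against (3). *)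

(** * Greedy coloring of the natural numbers *)

Section GreedyColoring.

Variables (T : finType) (f : T -> nat -> nat).

(** A color for the vertex [size s], where [s] lists the colors of all smaller
vertices; the default of [nth] is reached only for neighbors [f t (size s)] that
are not smaller, whose avoidance is harmless. *)
Definition fresh_color (s : seq 'I_#|T|.+1) : 'I_#|T|.+1 :=
  odflt ord0 [pick k | k \notin [seq nth ord0 s (f t (size s)) | t : T]].

Fixpoint greedy_prefix m : seq 'I_#|T|.+1 :=
  if m is m'.+1 then rcons (greedy_prefix m') (fresh_color (greedy_prefix m'))
  else [::].

Definition greedy_color v := fresh_color (greedy_prefix v).

Lemma size_greedy_prefix m : size (greedy_prefix m) = m.
Proof. by elim: m => //= m IH; rewrite size_rcons IH. Qed.

Lemma nth_greedy_prefix m v :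
  (v < m)%N -> nth ord0 (greedy_prefix m) v = greedy_color v.
Proof.
elim: m => //= m IH; rewrite ltnS leq_eqVlt nth_rcons size_greedy_prefix.
by case/orP => [/eqP->|lt_vm]; [rewrite ltnn eqxx | rewrite lt_vm IH].
Qed.

(** By pigeonhole: [#|T|] neighbors cannot use up [#|T|.+1] colors. *)
Lemma fresh_colorP s t : fresh_color s != nth ord0 s (f t (size s)).
Proof.
rewrite /fresh_color; case: pickP => [k /=|no_fresh].
  by apply: contra => /eqP->; apply/mapP; exists t; rewrite ?mem_enum.
have : (#|'I_#|T|.+1| <= size [seq nth ord0 s (f t (size s)) | t : T])%N.
  apply: leq_trans (card_size _); apply/subset_leq_card/subsetP => k _.
  exact/negbFE/no_fresh.
by rewrite size_image card_ord ltnn.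
Qed.

Lemma greedy_colorP t v :
  (f t v < v)%N -> greedy_color (f t v) != greedy_color v.
Proof.
move=> lt_fv; rewrite eq_sym -(nth_greedy_prefix lt_fv).
by have := fresh_colorP (greedy_prefix v) t; rewrite size_greedy_prefix.
Qed.

End GreedyColoring.

(** Each relation n l * v + d = n k * w + e determines either of v and w from the
other, so every vertex has at most one neighbor for each of the finitely many
(l, k, d, e).  This family of parameters is closed under exchanging the two
sides, so it suffices that the greedy coloring separates each vertex from its
smaller neighbors. *)
Lemma separating_coloring (h : nat) (n : 'I_h -> nat) (E : nat) :
  (forall l, 0 < n l)%N ->
  exists r (g : nat -> 'I_r), forall l k v w d e,
    (d < E)%N -> (e < E)%N -> g v = g w ->
    (n l * v + d = n k * w + e)%N -> v = w.
Proof.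
move=> n_gt0.
pose f (t : 'I_h * 'I_h * 'I_E * 'I_E) v :=
  let: (l, k, d, e) := t in ((n l * v + d - e) %/ n k)%N.
have fE l k v w d e (ltd : (d < E)%N) (lte : (e < E)%N) :
    (n l * v + d = n k * w + e)%N -> f (l, k, Ordinal ltd, Ordinal lte) v = w.
  by move=> eq_vw /=; rewrite eq_vw addnK mulKn.
exists _, (greedy_color f) => l k v w d e ltd lte eq_col eq_vw.
case: (ltngtP v w) => // [lt_vw|lt_wv].
  have fw := fE _ _ _ _ _ _ lte ltd (esym eq_vw).
  have := @greedy_colorP _ f (k, l, Ordinal lte, Ordinal ltd) w.
  by rewrite fw eq_col eqxx => /(_ lt_vw).
have fv := fE _ _ _ _ _ _ ltd lte eq_vw.
have := @greedy_colorP _ f (l, k, Ordinal ltd, Ordinal lte) v.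
by rewrite fv eq_col eqxx => /(_ lt_wv).
Qed.

(** * Exact p-adic valuation of a sum *)

Lemma PoszX (m n : nat) : (m ^ n)%N%:Z = m%:Z ^+ n.
Proof. by elim: n => // n IHn; rewrite expnS exprS PoszM IHn. Qed.

(** The p-adic valuation of z is m.  Two divisibilities are used rather than
[logn], because they are compatible with sums and exclude z = 0. *)
Definition exact_val (p m : nat) (z : int) : bool :=
  ((p ^ m)%:Z %| z)%Z && ~~ ((p ^ m.+1)%:Z %| z)%Z.

Lemma exact_val_neq0 p m z : exact_val p m z -> z != 0.
Proof. by case/andP=> _; apply: contraNneq => ->; apply: dvdz0. Qed.

Lemma exact_valD p m y z :
  exact_val p m y -> ((p ^ m.+1)%:Z %| z)%Z -> exact_val p m (y + z).
Proof.
case/andP=> dy ndy dz; have dz' : ((p ^ m)%:Z %| z)%Z.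
  by apply: dvdz_trans dz; rewrite expnSr PoszM dvdz_mulr.
by rewrite /exact_val !rpredDr // dy.
Qed.

Lemma exact_val_logn p z : prime p -> z != 0 -> exact_val p (logn p `|z|) z.
Proof.
move=> p_pr nz_z; have z_gt0: (0 < `|z|)%N by rewrite absz_gt0.
by rewrite /exact_val !dvdzE /= !pfactor_dvdn // leqnn ltnn.
Qed.

Lemma exact_val_pexp p m d z :
  (0 < p)%N -> exact_val p m z -> exact_val p (d + m) ((p ^ d)%:Z * z).
Proof.
move=> p_gt0; have nz: (p ^ d)%:Z != 0 by rewrite eqz_nat -lt0n expn_gt0 p_gt0.
by rewrite /exact_val -addnS !expnD !PoszM !dvdz_mul2l.
Qed.

Lemma exact_val_coprime p m u z :
  coprime p u -> exact_val p m z -> exact_val p m (u%:Z * z).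
Proof.
move=> co_pu; rewrite /exact_val.
by rewrite !Gauss_dvdzr ?coprimezE /= ?coprimeXl.
Qed.

(** Ultrametric principle: the term of least valuation dominates all others. *)
Lemma exact_val_sum_inj (I : finType) p (F : I -> int) (t : I -> nat) (i0 : I) :
    (forall i, exact_val p (t i) (F i)) -> injective t ->
  \sum_i F i != 0.
Proof.
move=> valF inj_t; case: (arg_minnP t (isT : xpredT i0)) => j _ min_j.
rewrite (bigD1 j) //=; apply: (@exact_val_neq0 p (t j)).
apply: exact_valD => //; apply: rpred_sum => i ne_ij.
have /andP[dFi _] := valF i; apply: dvdz_trans dFi.
rewrite dvdzE dvdn_exp2l // ltn_neqAle min_j // andbT.
by apply: contraNneq ne_ij => /inj_t->.
Qed.

Lemma dvdz_sum_powB (I : finType) (P : pred I) (a : I -> int) (y : I -> int)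
    (d y0 : int) n :
  (forall i, P i -> d %| y i - y0)%Z ->
  (d %| \sum_(i | P i) a i * y i ^+ n - y0 ^+ n * \sum_(i | P i) a i)%Z.
Proof.
move=> dy; rewrite mulr_sumr -sumrB; apply: rpred_sum => i Pi.
by rewrite [y0 ^+ n * _]mulrC -mulrBr dvdz_mull // subrXX dvdz_mulr ?dy.
Qed.

(** * The blocks of the equation *)

(** The terms outside G have valuation above n * v + e, and those inside
contribute p ^ (n * v) times an integer congruent modulo p ^ E to
u ^+ n * \sum_(i in G) a i, whose valuation is e < E. *)
Lemma exact_val_block (s p n E v u : nat) (a : 'I_s -> int) (x : 'I_s -> nat) :
  let G := [set i | logn p (x i) == v] in
  let e := logn p `|\sum_(i in G) a i| in
    prime p -> coprime p u -> (forall i, 0 < x i)%N ->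
    (forall i, (x i)`_p^' = u %[mod p ^ E])%N ->
    \sum_(i in G) a i != 0 -> (e < E)%N ->
    (forall i, i \notin G -> (n * v + e < n * logn p (x i))%N) ->
  exact_val p (n * v + e) (\sum_i a i * (x i)%:Z ^+ n).
Proof.
move=> G e p_pr co_pu x_gt0 x_u nzG ltE high.
have xE i : (x i)%:Z ^+ n
    = (p ^ (n * logn p (x i)))%:Z * ((x i)`_p^')%N%:Z ^+ n.
  rewrite -{1}(partnC p (x_gt0 i)) p_part PoszM exprMn -!PoszX -expnM.
  by rewrite [(n * _)%N]mulnC.
rewrite (bigID (mem G)) /=; apply: exact_valD; last first.
  apply: rpred_sum => i nGi.
  by rewrite xE dvdz_mull // dvdz_mulr // dvdzE dvdn_exp2l // high.
rewrite (eq_bigr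
    (fun i => (p ^ (n * v))%:Z * (a i * ((x i)`_p^')%N%:Z ^+ n))); last first.
  by move=> i; rewrite inE => /eqP vi; rewrite xE vi mulrCA.
rewrite -mulr_sumr; apply: exact_val_pexp; first exact: prime_gt0.
(* The p-free parts agree with u modulo p ^ E, so the sum over G differs from
   u ^+ n * \sum_(i in G) a i by a multiple of p ^ E, hence of p ^ e.+1. *)
have dS : ((p ^ E)%:Z %| \sum_(i in G) a i * ((x i)`_p^')%N%:Z ^+ n
                           - u%:Z ^+ n * \sum_(i in G) a i)%Z.
  by apply: dvdz_sum_powB => i _; rewrite -eqz_mod_dvd !modz_nat x_u.
rewrite -[X in exact_val _ _ X](subrK (u%:Z ^+ n * \sum_(i in G) a i)) addrC.
apply: exact_valD; last by apply: dvdz_trans dS; rewrite dvdzE dvdn_exp2l.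
rewrite -PoszX; apply: exact_val_coprime; first by rewrite coprimeXr.
exact: exact_val_logn.
Qed.

(** Modulo p every block l is u ^+ n l times its coefficient sum, so only the
block l' survives. *)
Lemma diagonal_form_ndvd (h : nat) (n s : 'I_h -> nat)
    (a : forall l : 'I_h, 'I_(s l) -> int) (x : {l : 'I_h & 'I_(s l)} -> nat)
    (p u : nat) (l' : 'I_h) :
    prime p -> coprime p u ->
    ~~ (p%:Z %| \sum_(i < s l') a l' i)%Z ->
    (forall l : 'I_h, l != l' -> (p%:Z %| \sum_(i < s l) a l i)%Z) ->
    (forall i, p%:Z %| (x i)%:Z - u%:Z)%Z ->
  ~~ (p%:Z %| diagonal_form n a x)%Z.
Proof.
move=> p_pr co_pu ndvd_l' dvd_l x_u.
pose S l := \sum_(i < s l) a l i * (x (Tagged (fun l => 'I_(s l)) i))%:Z ^+ n l.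
have S_u l : (p%:Z %| S l - u%:Z ^+ n l * \sum_i a l i)%Z.
  exact: dvdz_sum_powB.
have dvd_S l : l != l' -> (p%:Z %| S l)%Z.
  move=> ne_ll'; rewrite -(subrK (u%:Z ^+ n l * \sum_i a l i) (S l)).
  by rewrite rpredD ?S_u // dvdz_mull ?dvd_l.
apply: contra ndvd_l'; rewrite /diagonal_form (bigD1 l') //= rpredDr; last first.
  exact: rpred_sum.
move=> dvd_Sl'; rewrite -(@Gauss_dvdzr _ (u%:Z ^+ n l')).
  by rewrite -[X in (_ %| X)%Z](subKr (S l')) rpredB ?S_u.
by rewrite coprimezE abszX coprimeXr.
Qed.

Theorem theorem2p4 (h : nat) (n s : 'I_h -> nat)
  (a : forall l : 'I_h, 'I_(s l) -> int) (p : nat)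
  (h_ge1 : (1 <= h)%N)
  (n_gt0 : forall l : 'I_h, (0 < n l)%N)
  (n_incr : forall l k : 'I_h, (l < k)%N -> (n l < n k)%N)
  (s_gt0 : forall l : 'I_h, (0 < s l)%N)
  (H1 : forall (l : 'I_h) (G : {set 'I_(s l)}), G != set0 ->
     \sum_(i in G) a l i != 0)
  (p_prime : prime p)
  (H2 : exists l' : 'I_h,
     ~~ (p%:Z %| \sum_(i < s l') a l' i)%Z /\
     (forall l : 'I_h, l != l' -> (p%:Z %| \sum_(i < s l) a l i)%Z))
  (H3 : forall l k : 'I_h, (l < k)%N ->
     forall G : {set 'I_(s l)}, G != set0 ->
       ~~ (p%:Z ^+ (n k - n l)%N %| \sum_(i in G) a l i)%Z) :
  not_partition_regular_except_constant (diagonal_form n a).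
Proof.
have [l' [ndvd_l' dvd_l]] := H2.
pose e l (G : {set 'I_(s l)}) := logn p `|\sum_(i in G) a l i|.
pose E := (\max_l \max_G e l G).+1.
have e_ltE l G : (e l G < E)%N.
  rewrite ltnS.
  apply: leq_trans (leq_bigmax (F := fun l => \max_G e l G) l).
  exact: leq_bigmax.
have [r [g sep_g]] := separating_coloring E n_gt0.
have pE_gt0 : (0 < p ^ E)%N by rewrite expn_gt0 prime_gt0.
pose color z : bool * 'I_r * 'I_(p ^ E) :=
  (logn p z == 0%N, g (logn p z), Ordinal (ltn_pmod (z`_p^')%N pE_gt0)).
exists _, (fun z => enum_rank (color z)) => x [x_gt0 x_sol] [k x_k]; exfalso.
pose i0 := Tagged (fun l => 'I_(s l)) (Ordinal (s_gt0 l')).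
have{x_k k} same_color i : color (x i) = color (x i0).
  by apply: enum_rank_inj; rewrite !x_k.
set u := ((x i0)`_p^')%N.
have x_u i : ((x i)`_p^' = u %[mod p ^ E])%N by case: (same_color i).
have co_pu : coprime p u.
  by rewrite prime_coprime // -p'natE // part_pnat.
have [v0|v_neq0] := eqVneq (logn p (x i0)) 0%N.
  have x_modp i : (p%:Z %| (x i)%:Z - u%:Z)%Z.
    have vi : logn p (x i) = 0%N.
      by apply/eqP; case: (same_color i) => ->; rewrite v0.
    have -> : x i = ((x i)`_p^')%N.
      by rewrite -{1}(partnC p (x_gt0 i)) p_part vi mul1n.
    apply: (@dvdz_trans (p ^ E)%:Z); first by rewrite dvdzE expnS dvdn_mulr.
    by rewrite -eqz_mod_dvd !modz_nat x_u.
  have /negP := diagonal_form_ndvd n p_prime co_pu ndvd_l' dvd_l x_modp; apply.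
  by rewrite x_sol dvdz0.
pose w l (i : 'I_(s l)) := logn p (x (Tagged (fun l => 'I_(s l)) i)).
pose m l := [arg min_(i < Ordinal (s_gt0 l)) w l i]%N.
have w_min l i : (w l (m l) <= w l i)%N.
  by rewrite /m; case: arg_minnP => // j _; apply.
pose G l := [set i | w l i == w l (m l)].
have G_neq0 l : G l != set0 by apply/set0Pn; exists (m l); rewrite inE.
have same_g i j : g (logn p (x i)) = g (logn p (x j)).
  by have [_ -> _] := same_color i; have [_ -> _] := same_color j.
pose t l := (n l * w l (m l) + e l (G l))%N.
(* t l is the valuation of block l. *)
have t_lt (l k : 'I_h) : (l < k)%N -> t l <> t k.
  move=> lt_lk eq_t.
  have w_eq : w l (m l) = w k (m k).
    exact: sep_g (e_ltE _ _) (e_ltE _ _) (same_g _ _) eq_t.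
  have w_gt0 : (0 < w k (m k))%N.
    rewrite lt0n /w.
    by case: (same_color (Tagged (fun l => 'I_(s l)) (m k))) => ->.
  have /negP := H3 _ _ lt_lk _ (G_neq0 l); apply.
  rewrite dvdzE abszX pfactor_dvdn ?absz_gt0 ?H1 ?G_neq0 //= -/(e l (G l)).
  move: eq_t; rewrite /t w_eq; have := n_incr _ _ lt_lk; nia.
have t_inj : injective t.
  move=> l k eq_t; case: (ltngtP l k) => [/t_lt //|/t_lt ne_t|/val_inj //].
  by case: ne_t.
suff : diagonal_form n a x != 0 by rewrite x_sol eqxx.
apply: (exact_val_sum_inj l' _ t_inj) => l.
apply: (exact_val_block p_prime co_pu _ _ (H1 _ _ (G_neq0 l))
          (e_ltE l (G l))) => // i.
rewrite inE -/(w l i) ltnNge; apply: contra => le_n.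
have le_w := w_min l i; apply/eqP.
(* If index i had too small a valuation, the gap d between n l * w l i and
   n l * w l (m l) would be less than E, and the coloring g would identify
   w l i with the minimum. *)
apply: (sep_g l l _ _ 0%N (n l * w l i - n l * w l (m l))%N) => //.
- by rewrite (leq_ltn_trans _ (e_ltE l (G l))) // leq_subLR.
- exact: same_g.
- by rewrite addn0 subnKC // leq_mul2l le_w orbT.
Qed.
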